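(* Fix $(k_1,k_2,k_3)\in\mathbb Z_{\ge0}^3$ and $\sigma\in\mathfrak S_3$. For every reduced fraction $t\in(0,\infty)\cap\mathbb Q$, \[ C_t=\begin{bmatrix}-1&0\\0&1\end{bmatrix}\overline M_t\begin{bmatrix}1&0\\0&-1\end{bmatrix}, \] where $C_t$ is the $(k_1,k_2,k_3,\sigma)$-generalized Cohn matrix attached to $t$ and $\overline M_t$ is the endpoint-completed matrix.
   Context: $K:=3+k_1+k_2+k_3$. Farey tree $\mathrm{F}\mathbb T$: rooted planar binary tree with root $(\frac01,\frac11,\frac10)$, each vertex $(\frac ab,\frac cd,\frac ef)$ having left child $(\frac ab,\frac{a+c}{b+d},\frac cd)$ and right child $(\frac cd,\frac{c+e}{d+f},\frac ef)$ ($\frac10$ represents $\infty$); write $r\oplus t$ for the mediant. Labeled GM tree $\mathrm M\mathbb T(k_1,k_2,k_3,\sigma)$: rooted planar binary tree with root $((1,\sigma(1)),(k_{\sigma(2)}+2,\sigma(2)),(1,\sigma(3)))$; a vertex $((a,h),(b,i),(c,j))$ has left child $((a,h),(\frac{a^2+k_jab+b^2}{c},j),(b,i))$ and right child $((b,i),(\frac{b^2+k_hbc+c^2}{a},h),(c,j))$. For a vertex $(r,t,s)$ of $\mathrm{F}\mathbb T$, let $((m_r,i_r),(m_t,i_t),(m_s,i_s))$ be the vertex of $\mathrm M\mathbb T$ at the same position, and set $k_r:=k_{i_r}$ (similarly $k_s:=k_{i_s}$); this depends only on the rational, not the vertex. Generalized Cohn matrices: $C_{0/1}=\begin{bmatrix}K&-Kk_{\sigma(1)}-1\\1&-k_{\sigma(1)}\end{bmatrix}$,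 $C_{1/1}=\begin{bmatrix}K(k_{\sigma(2)}+2)-k_{\sigma(2)}-1&K-1\\k_{\sigma(2)}+2&1\end{bmatrix}$, $C_{1/0}=\begin{bmatrix}K-k_{\sigma(3)}-1&K-k_{\sigma(3)}-2\\1&1\end{bmatrix}$, and for every vertex $(r,t,s)$ of $\mathrm{F}\mathbb T$, $C_{r\oplus t}=C_rC_t-D_s$ and $C_{t\oplus s}=C_tC_s-D_r$, where $D_u:=\begin{bmatrix}k_u&Kk_u\\0&k_u\end{bmatrix}$. Modified lattice: the planar graph with vertex set $\mathbb Z^2$ whose edges are the horizontal unit segments, the vertical unit segments, and the diagonal segments of slope $-1$ joining $(i,j+1)$ and $(i+1,j)$. Endpoint-completed word $\overline\omega_t$: for $t=p/q$ reduced, choose $\varepsilon>0$ sufficiently small (so that the shifted segment has the same order of edge and triangle events away from the endpoints and passes through no lattice vertex and no edge midpoint), and let $\overline L_t$ be the segment from $(-\varepsilon,0)$ to $(q-\varepsilon,p)$, oriented from lower left to upper right. Read the edges of the modified lattice crossed by $\overline L_t$ in order, with the half-open convention that the horizontal edge containing the initial endpoint is counted as crossed and the edge containing the terminal endpoint is not. A horizontal (resp. diagonal, vertical) edge contributes $x$ (resp. $y$, $z$) if its midpoint is not on the right-hand side of $\overline L_t$, and $x^{-1}$ (resp. $y^{-1}$, $z^{-1}$) if it is. The concatenation is $\overline\omega_t$. Endpoint-completed matrix: $\overline M_t$ is obtained from $\overline\omega_t$ by substituting $x\mapsto X=\begin{bmatrix}-k_{\sigma(1)}&-1\\1&0\end{bmatrix}$,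 $y\mapsto Y=\begin{bmatrix}1&-1\\k_{\sigma(2)}+2&-k_{\sigma(2)}-1\end{bmatrix}$, $z\mapsto Z=\begin{bmatrix}1&-k_{\sigma(3)}-2\\1&-k_{\sigma(3)}-1\end{bmatrix}$ and multiplying. *)

(* Defs.v *)
From HB Require Import structures.
From mathcomp Require Import all_boot all_order all_algebra all_fingroup.
Set Implicit Arguments. Unset Strict Implicit. Unset Printing Implicit Defensive.
Import Order.TTheory GRing.Theory Num.Theory.
Local Open Scope ring_scope.

Definition kk (k1 k2 k3 : nat) (i : 'I_3) : nat := nth 0%N [:: k1; k2; k3] i.
Definition bigK (k1 k2 k3 : nat) : int := (3 + k1 + k2 + k3)%N%:Z.

Definition s1 (s : 'S_3) : 'I_3 := s ord0.
Definition s2 (s : 'S_3) : 'I_3 := s (inord 1).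
Definition s3 (s : 'S_3) : 'I_3 := s (inord 2).

Definition mx2 (a b c d : int) : 'M[int]_2 :=
  \matrix_(i < 2, j < 2)
    if (i : nat) == 0%N then (if (j : nat) == 0%N then a else b)
    else (if (j : nat) == 0%N then c else d).

(* Vertices of rooted planar binary trees are addressed by paths from the
   root: a path is a seq bool read from the root, false = left child,
   true = right child. *)

(* Farey tree: a fraction a/b is the pair (a,b); 1/0 represents infinity. *)
Definition frac := (nat * nat)%type.
Definition mediant (r t : frac) : frac := (r.1 + t.1, r.2 + t.2)%N.
Definition FT_root : frac * frac * frac := ((0, 1), (1, 1), (1, 0))%N.
Definition FT_step (v : frac * frac * frac) (right : bool) :=
  let: (r, t, s) := v in
  if right then (t, mediant t s, s) else (r, mediant r t, t).
Definition FT_vertex (w : seq bool) := foldl FT_step FT_root w.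
Definition FT_mid (w : seq bool) : frac := (FT_vertex w).1.2.

Definition lab := (nat * 'I_3)%type.
Definition MT_root k1 k2 k3 (s : 'S_3) : lab * lab * lab :=
  ((1%N, s1 s), ((kk k1 k2 k3 (s2 s) + 2)%N, s2 s), (1%N, s3 s)).
Definition MT_step k1 k2 k3 (v : lab * lab * lab) (right : bool) :=
  let: ((a, h), (b, i), (c, j)) := v in
  if right then
    ((b, i), ((b ^ 2 + kk k1 k2 k3 h * b * c + c ^ 2) %/ a, h), (c, j))%N
  else
    ((a, h), ((a ^ 2 + kk k1 k2 k3 j * a * b + b ^ 2) %/ c, j), (b, i))%N.
Definition MT_vertex k1 k2 k3 s (w : seq bool) :=
  foldl (MT_step k1 k2 k3) (MT_root k1 k2 k3 s) w.

Definition C01 k1 k2 k3 s : 'M[int]_2 :=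
  let K := bigK k1 k2 k3 in let k := (kk k1 k2 k3 (s1 s))%:Z in
  mx2 K (- K * k - 1) 1 (- k).
Definition C11 k1 k2 k3 s : 'M[int]_2 :=
  let K := bigK k1 k2 k3 in let k := (kk k1 k2 k3 (s2 s))%:Z in
  mx2 (K * (k + 2) - k - 1) (K - 1) (k + 2) 1.
Definition C10 k1 k2 k3 s : 'M[int]_2 :=
  let K := bigK k1 k2 k3 in let k := (kk k1 k2 k3 (s3 s))%:Z in
  mx2 (K - k - 1) (K - k - 2) 1 1.
Definition Dmx k1 k2 k3 (u : nat) : 'M[int]_2 :=
  let K := bigK k1 k2 k3 in mx2 u%:Z (K * u%:Z) 0 u%:Z.

(* The state at a vertex (r,t,s): the MT vertex at the same position
   (giving k_r, k_s) and the triple (C_r, C_t, C_s). *)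
Definition Cstate := ((lab * lab * lab) * ('M[int]_2 * 'M[int]_2 * 'M[int]_2))%type.
Definition C_root k1 k2 k3 s : Cstate :=
  (MT_root k1 k2 k3 s, (C01 k1 k2 k3 s, C11 k1 k2 k3 s, C10 k1 k2 k3 s)).
Definition C_step k1 k2 k3 (st : Cstate) (right : bool) : Cstate :=
  let: (v, (Cr, Ct, Cs)) := st in
  let: ((_, ir), _, (_, is_)) := v in
  let kr := kk k1 k2 k3 ir in
  let ks := kk k1 k2 k3 is_ in
  (MT_step k1 k2 k3 v right,
   if right then (Ct, Ct *m Cs - Dmx k1 k2 k3 kr, Cs)
   else (Cr, Cr *m Ct - Dmx k1 k2 k3 ks, Ct)).
Definition C_vertex k1 k2 k3 s (w : seq bool) :=
  foldl (C_step k1 k2 k3) (C_root k1 k2 k3 s) w.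
Definition Cohn_mid k1 k2 k3 s (w : seq bool) : 'M[int]_2 :=
  (C_vertex k1 k2 k3 s w).2.1.2.

(* Endpoint-completed word.  The shift epsilon > 0 "sufficiently small" is
   treated as a formal infinitesimal: a quantity a + b*eps is the pair (a,b),
   compared lexicographically (which is exactly the comparison for all
   sufficiently small eps > 0).  All geometric quantities below are affine
   in eps. *)
Definition epsr := (rat * rat)%type.
Definition eps_of (a : rat) : epsr := (a, 0).
Definition eD (u v : epsr) : epsr := (u.1 + v.1, u.2 + v.2).
Definition eZ (c : rat) (u : epsr) : epsr := (c * u.1, c * u.2).
Definition elt (u v : epsr) : bool := (u.1 < v.1) || ((u.1 == v.1) && (u.2 < v.2)).
Definition ele (u v : epsr) : bool := (u.1 < v.1) || ((u.1 == v.1) && (u.2 <= v.2)).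

Inductive letter := Lx | Ly | Lz.

(* Candidate edge: initial vertex E0 = (x0,y0), direction e = (ex,ey), letter.
   Horizontal: (i,j)--(i+1,j), letter x; vertical: (i,j)--(i,j+1), letter z;
   diagonal of slope -1: (i,j+1)--(i+1,j), letter y. *)
Definition edge := ((rat * rat) * (rat * rat) * letter)%type.

(* Segment \bar L_t from A = (-eps, 0) to B = (q - eps, p), direction d = (q,p).
   For an edge E0 + mu e (0<=mu<=1), the intersection with A + lam d is
   lam = cross(E0 - A, e) / cross(d, e),  mu = cross(E0 - A, d) / cross(d, e). *)
Definition crossing (p q : nat) (E : edge) : option (epsr * (letter * bool)) :=
  let: ((x0, y0), (ex, ey), l) := E in
  let dx : rat := q%:R in let dy : rat := p%:R in
  (* w = E0 - A = (x0 + eps, y0) *)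
  let wx : epsr := (x0, 1) in let wy : epsr := eps_of y0 in
  let den := dx * ey - dy * ex in
  let lam := eZ den^-1 (eD (eZ ey wx) (eZ (- ex) wy)) in
  let mu := eZ den^-1 (eD (eZ dy wx) (eZ (- dx) wy)) in
  (* midpoint minus A *)
  let mx := eD wx (eps_of (ex / 2)) in let my := eD wy (eps_of (ey / 2)) in
  let side := eD (eZ dx my) (eZ (- dy) mx) in   (* cross(d, M - A) *)
  let on_right := elt side (eps_of 0) in
  if [&& ele (eps_of 0) lam, elt lam (eps_of 1), ele (eps_of 0) mu
       & ele mu (eps_of 1)]
  then Some (lam, (l, ~~ on_right)) else None.

(* All lattice edges with initial-corner coordinates in [-1, q] x [-1, p];
   this finite box contains every edge that the segment can meet. *)
Definition cand_edges (p q : nat) : seq edge :=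
  flatten [seq flatten [seq
      let i : rat := a%:R - 1 in let j : rat := b%:R - 1 in
      [:: ((i, j), (1, 0), Lx); ((i, j), (0, 1), Lz); ((i, j + 1), (1, -1), Ly)]
    | b <- iota 0 (p + 2)] | a <- iota 0 (q + 2)].

(* \bar omega_t for t = p/q: crossed edges read in order along the segment;
   a pair (l, true) is the letter l, (l, false) is l^{-1}. *)
Definition omega_bar (p q : nat) : seq (letter * bool) :=
  map snd (sort (fun u v : epsr * (letter * bool) => ele u.1 v.1)
                (pmap (crossing p q) (cand_edges p q))).

Definition Xmx k1 k2 k3 s : 'M[int]_2 :=
  let k := (kk k1 k2 k3 (s1 s))%:Z in mx2 (- k) (-1) 1 0.
Definition Ymx k1 k2 k3 s : 'M[int]_2 :=
  let k := (kk k1 k2 k3 (s2 s))%:Z in mx2 1 (-1) (k + 2) (- k - 1).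
Definition Zmx k1 k2 k3 s : 'M[int]_2 :=
  let k := (kk k1 k2 k3 (s3 s))%:Z in mx2 1 (- k - 2) 1 (- k - 1).

Definition letter_mx k1 k2 k3 s (x : letter * bool) : 'M[int]_2 :=
  let M := match x.1 with
           | Lx => Xmx k1 k2 k3 s | Ly => Ymx k1 k2 k3 s | Lz => Zmx k1 k2 k3 s end in
  if x.2 then M else invmx M.

Definition Mbar k1 k2 k3 s (p q : nat) : 'M[int]_2 :=
  foldr (fun x acc => letter_mx k1 k2 k3 s x *m acc) 1%:M (omega_bar p q).

(* Main.v *)
(* Put d = p + q.  Letter number m = 2n or 2n + 1 of the completed word of p/q
   depends only on the residue r of p n modulo d: it is x, z or y, and its
   exponent is the sign of an integer deviation ([dev] below).  When
   p2 q1 - p1 q2 = 1, the letters of (p1+p2)/(q1+q2) agree with those of p1/q1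
   followed by those of p2/q2, except for the central letter, which changes
   from l to l^-1; and away from its first three letters the word is
   antisymmetric about that central letter.  As l^-1 = tr l - l for matrices of
   determinant 1, the central change gives W = - W1 W2 + (tr l) A B, and by
   antisymmetry the product A B of everything but the central letter collapses
   to a fixed matrix.  This is the Cohn recursion up to conjugation.  The
   letters at both ends of the Farey tree only fit this pattern after moving
   the initial x to the end of the word, i.e. after conjugating by X. *)
Require Import Defs.
From HB Require Import structures.
From mathcomp Require Import all_boot all_order all_algebra all_fingroup.
From mathcomp Require Import zify ring lra.
Set Implicit Arguments. Unset Strict Implicit. Unset Printing Implicit Defensive.
Import Order.TTheory GRing.Theory Num.Theory.
Local Open Scope ring_scope.

(** * Rotation coding of the completed word *)

Definition resid (p q n : nat) : nat := (p * n %% (p + q))%N.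

(* Minus twice the cross product of the direction (q, p) with the vector from
   the unshifted segment to the midpoint of the crossed edge; when it vanishes
   the infinitesimal shift leaves the midpoint on the right. *)
Definition dev (p q m : nat) : letter * int :=
  let r := resid p q m./2 in
  if odd m then (Ly, r.*2%:Z - (p + q)%:Z)
  else if (r < p)%N then (Lx, r.*2%:Z - p%:Z)
  else (Lz, r.*2%:Z - p.*2%:Z - q%:Z).

Definition code (p q m : nat) : letter * bool :=
  ((dev p q m).1, (dev p q m).2 < 0).

Lemma residP (p q n f r : nat) :
  (p * n = f * (p + q) + r)%N -> (r < p + q)%N -> resid p q n = r.
Proof. by move=> e lt_r; rewrite /resid e modnMDl modn_small. Qed.

(** With d1 = p1 + q1 and d = p1 + p2 + q1 + q2, the determinant condition gives d1 (p1 + p2) = d p1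
    + 1. Multiplying by n yields a drift of n, too small to change the quotient. *)
Lemma resid_mediantl (p1 q1 p2 q2 n : nat) :
  (p2 * q1 = p1 * q2 + 1)%N -> (n <= p1 + q1)%N ->
  ((p1 + q1) * resid (p1 + p2) (q1 + q2) n
   = (p1 + p2 + (q1 + q2)) * resid p1 q1 n + n)%N.
Proof.
move=> det le_n.
have [p2_gt0 q1_gt0] : (0 < p2)%N /\ (0 < q1)%N by nia.
have d1_gt0 : (0 < p1 + q1)%N by lia.
have lt_r1 : (resid p1 q1 n < p1 + q1)%N by rewrite ltn_mod.
have e1 := divn_eq (p1 * n) (p1 + q1); rewrite -/(resid p1 q1 n) in e1.
move: (resid p1 q1 n) (_ %/ _)%N lt_r1 e1 => r1 f lt_r1 e1.
have e : ((p1 + q1) * ((p1 + p2) * n)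
          = (p1 + q1) * (f * (p1 + p2 + (q1 + q2)))
            + ((p1 + p2 + (q1 + q2)) * r1 + n))%N.
  have -> : ((p1 + q1) * ((p1 + p2) * n)
          = (p1 + p2 + (q1 + q2)) * (p1 * n) + n)%N.
    have -> : ((p1 + q1) * ((p1 + p2) * n)
       = ((p1 + p2) * p1 + p1 * q1 + p2 * q1) * n)%N by lia.
    by rewrite det; lia.
  by rewrite e1; lia.
have le_f : (f * (p1 + p2 + (q1 + q2)) <= (p1 + p2) * n)%N.
  by rewrite -(leq_pmul2l d1_gt0) e leq_addr.
have := subnKC le_f; move: (_ - _)%N => r er.
have e' : ((p1 + q1) * r = (p1 + p2 + (q1 + q2)) * r1 + n)%N by lia.
rewrite (@residP _ _ n f r) //.
rewrite -(ltn_pmul2l d1_gt0) e'.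
apply: (@leq_trans ((p1 + p2 + (q1 + q2)) * r1.+1)%N); first by lia.
by rewrite mulnC leq_mul2r lt_r1 orbT.
Qed.

(** Now (p1 + p2) (p1 + q1) = d p1 + 1 and d2 (p1 + p2) = d p2 - 1, so the drift starts at d2 and
    loses 1 with each n. *)
Lemma resid_mediantr (p1 q1 p2 q2 n : nat) :
  (p2 * q1 = p1 * q2 + 1)%N -> (n <= p2 + q2)%N ->
  ((p2 + q2) * resid (p1 + p2) (q1 + q2) (p1 + q1 + n)
   = (p1 + p2 + (q1 + q2)) * resid p2 q2 n + (p2 + q2 - n))%N.
Proof.
move=> det le_n.
have [p2_gt0 q1_gt0] : (0 < p2)%N /\ (0 < q1)%N by nia.
have d2_gt0 : (0 < p2 + q2)%N by lia.
have lt_r2 : (resid p2 q2 n < p2 + q2)%N by rewrite ltn_mod.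
have e2 := divn_eq (p2 * n) (p2 + q2); rewrite -/(resid p2 q2 n) in e2.
move: (resid p2 q2 n) (_ %/ _)%N lt_r2 e2 => r2 f lt_r2 e2.
have [c ec] : exists c, (p2 + q2 = n + c)%N by exists (p2 + q2 - n)%N; lia.
have -> : (p2 + q2 - n = c)%N by lia.
have e : ((p2 + q2) * ((p1 + p2) * (p1 + q1 + n))
          = (p2 + q2) * ((p1 + f) * (p1 + p2 + (q1 + q2)))
            + ((p1 + p2 + (q1 + q2)) * r2 + c))%N.
  have : ((p2 + q2) * ((p1 + p2) * (p1 + q1 + n)) + n
      = (p1 + p2 + (q1 + q2)) * (p2 * n) +
        (p2 + q2) * (p1 * (p1 + p2 + (q1 + q2))) + (p2 + q2))%N.
    have e3 : ((p1 + p2) * (p1 + q1)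
       = p1 * (p1 + p2 + (q1 + q2)) + 1)%N by lia.
    have e4 : ((p2 + q2) * (p1 + p2) + 1 = (p1 + p2 + (q1 + q2)) * p2)%N by lia.
    rewrite mulnDr e3 mulnDr (mulnA (p1 + p2 + (q1 + q2)))%N -e4.
    by rewrite !mulnDr !mulnDl; lia.
  by rewrite e2 {5}ec; lia.
have le_f : ((p1 + f) * (p1 + p2 + (q1 + q2)) <= (p1 + p2) * (p1 + q1 + n))%N.
  by rewrite -(leq_pmul2l d2_gt0) e leq_addr.
have := subnKC le_f; move: (_ - _)%N => r er.
have e' : ((p2 + q2) * r = (p1 + p2 + (q1 + q2)) * r2 + c)%N by lia.
rewrite (@residP _ _ _ (p1 + f) r) //.
rewrite -(ltn_pmul2l d2_gt0) e'.
apply: (@leq_trans ((p1 + p2 + (q1 + q2)) * r2.+1)%N); first by lia.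
by rewrite mulnC leq_mul2r lt_r2 orbT.
Qed.

(** The doubled drift 2n equals m - 1 for odd m. For even m the threshold p1 + p2 contributes a
    further -1, which gives m - 1 again. *)
Lemma dev_mediantl (p1 q1 p2 q2 m : nat) :
  (p2 * q1 = p1 * q2 + 1)%N -> (0 < m <= (p1 + q1).*2)%N ->
  (dev (p1 + p2) (q1 + q2) m).1 = (dev p1 q1 m).1 /\
  (p1 + q1)%:Z * (dev (p1 + p2) (q1 + q2) m).2
    = (p1 + p2 + (q1 + q2))%:Z * (dev p1 q1 m).2 + m%:Z - 1.
Proof.
move=> det /andP[m_gt0 le_m]; have le_n : (m./2 <= p1 + q1)%N by lia.
have e := resid_mediantl det le_n; rewrite /dev.
move: (resid (p1 + p2) _ _) (resid p1 _ _) e => r r1 e.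
case: ifP => odd_m /=; first by split => //; lia.
have -> : (r < p1 + p2)%N = (r1 < p1)%N.
  have n_gt0 : (0 < m./2)%N by lia.
  have [p2_gt0 q1_gt0] : (0 < p2)%N /\ (0 < q1)%N by nia.
  have e3 : ((p1 + q1) * (p1 + p2) = p1 * (p1 + p2 + (q1 + q2)) + 1)%N by lia.
  by apply/idP/idP => H; nia.
by case: ifP => _ /=; split => //; lia.
Qed.

Lemma dev_mediantr (p1 q1 p2 q2 m : nat) :
  (p2 * q1 = p1 * q2 + 1)%N -> (0 < m <= (p2 + q2).*2)%N ->
  (dev (p1 + p2) (q1 + q2) ((p1 + q1).*2 + m)).1 = (dev p2 q2 m).1 /\
  (p2 + q2)%:Z * (dev (p1 + p2) (q1 + q2) ((p1 + q1).*2 + m)).2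
    = (p1 + p2 + (q1 + q2))%:Z * (dev p2 q2 m).2 + (p2 + q2).*2%:Z - m%:Z + 1.
Proof.
move=> det /andP[m_gt0 le_m]; have le_n : (m./2 <= p2 + q2)%N by lia.
have e := resid_mediantr det le_n; rewrite /dev.
have -> : (((p1 + q1).*2 + m)./2 = p1 + q1 + m./2)%N by lia.
move: (resid (p1 + p2) _ _) (resid p2 _ _) e => r r2 e.
have -> : odd ((p1 + q1).*2 + m) = odd m by lia.
case: ifP => odd_m /=; first by split => //; lia.
have -> : (r < p1 + p2)%N = (r2 < p2)%N.
  have n_gt0 : (0 < m./2)%N by lia.
  have [p2_gt0 q1_gt0] : (0 < p2)%N /\ (0 < q1)%N by nia.
  have e3 : ((p2 + q2) * (p1 + p2) + 1 = p2 * (p1 + p2 + (q1 + q2)))%N by lia.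
  have d2_gt0 : (0 < p2 + q2)%N by lia.
  have d_gt0 : (0 < p1 + p2 + (q1 + q2))%N by lia.
  rewrite -(ltn_pmul2l d2_gt0) -[RHS](ltn_pmul2l d_gt0).
  apply/idP/idP => H; first by lia.
  by move: H; rewrite ltn_pmul2l // -(leq_pmul2l d_gt0); lia.
by case: ifP => _ /=; split => //; lia.
Qed.

(** If B < 0 <= A, the bound c <= 2 d1 < 2 d leaves only B = -1, A = 0 and c = d. *)
Lemma sign_perturb (d1 d A B c : int) :
  0 < d1 < d -> 0 <= c <= 2 * d1 -> d1 * A = d * B + c -> c != d ->
  (A < 0) = (B < 0).
Proof.
move=> /andP[d1_gt0 lt_d] /andP[c_ge0 le_c] e /eqP c_neq.
apply/idP/idP => H; rewrite ltNge; apply/negP => H'; first by nia.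
have [A0|A_gt0] : A = 0 \/ 1 <= A by lia.
  have [B1|B2] : B = -1 \/ B <= -2 by lia.
    by lia.
  by nia.
nia.
Qed.

(** As p is invertible modulo p + q, the residue is nonzero; and p n + p n' = p (p + q). *)
Lemma resid_opp (p q n n' : nat) :
  coprime p q -> (0 < n < p + q)%N -> (n + n' = p + q)%N ->
  (0 < resid p q n)%N /\ (resid p q n + resid p q n' = p + q)%N.
Proof.
move=> co /andP[n_gt0 lt_n] e.
have r_gt0 : (0 < resid p q n)%N.
  rewrite lt0n; apply: contraTneq lt_n => /eqP.
  rewrite -[_ == _]/(p + q %| p * n)%N Gauss_dvdr; last first.
    by rewrite coprime_sym /coprime gcdnDl.
  by move=> /(dvdn_leq n_gt0); rewrite -leqNgt.
split=> //; have lt_r : (resid p q n < p + q)%N by rewrite ltn_mod; lia.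
have en := divn_eq (p * n) (p + q); rewrite -/(resid p q n) in en.
have p_gt0 : (0 < p)%N.
  by rewrite lt0n; apply: contraTneq r_gt0 => ->; rewrite /resid mul0n mod0n.
have le_f : ((p * n) %/ (p + q) < p)%N by rewrite ltn_divLR ?ltn_pmul2l //; lia.
rewrite (@residP p q n' (p - (p * n) %/ (p + q)).-1 (p + q - resid p q n)); [by lia| |by lia].
have : (p * n + p * n' = p * (p + q))%N by rewrite -mulnDr e.
move: (_ %/ _)%N le_f en => f le_f ->.
have [g eg] : exists g, p = (f + g.+1)%N by exists (p - f).-1; lia.
have : (p * (p + q) = (f + g.+1) * (p + q))%N by rewrite -eg.
have -> : (p - f).-1 = g by lia.
by lia.
Qed.

(** The half-turn about the midpoint of the unshifted segment permutes the lattice edges and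
    exchanges the two sides. It pairs the crossings other than the first three. *)
Lemma dev_opp (p q m m' : nat) :
  coprime p q -> (0 < p)%N -> (2 < m)%N -> (2 < m')%N ->
  (m + m' = (p + q).*2 + 2)%N ->
  (dev p q m').1 = (dev p q m).1 /\ (dev p q m').2 = - (dev p q m).2.
Proof.
move=> co p_gt0 m_gt2 m'_gt2 e; rewrite /dev.
have -> : odd m' = odd m by lia.
have [||r_gt0 er] := @resid_opp p q m./2 (p + q - m./2) co; [lia|lia|].
case: ifP => odd_m /=.
  have -> : m'./2 = (p + q - m./2)%N by lia.
  by split=> //; lia.
have lt_r : (resid p q m./2 < p + q)%N by rewrite ltn_mod; lia.
(* For even [m] the residue at [m'./2] is opposite to the one at [m./2 - 1],
   which is one rotation step away from the residue at [m./2]. *)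
have [||r'_gt0 er'] := @resid_opp p q (m./2).-1 m'./2 co; [lia|lia|].
have lt_r' : (resid p q (m./2).-1 < p + q)%N by rewrite ltn_mod; lia.
have step : resid p q m./2 = if (resid p q (m./2).-1 < q)%N then (resid p q (m./2).-1 + p)%N
                         else (resid p q (m./2).-1 - q)%N.
  have -> : resid p q m./2 = ((resid p q (m./2).-1 + p) %% (p + q))%N.
    by rewrite /resid modnDml -mulnSr prednK //; lia.
  case: ltnP => H; first by rewrite modn_small //; lia.
  by rewrite -[in LHS](subnK H) -addnA [(q + p)%N]addnC modnDr modn_small //; lia.
move: (resid p q m./2) (resid p q (m./2).-1) (resid p q m'./2)
  r_gt0 lt_r er' lt_r' step {er r'_gt0}.
move=> r r1 r' r_gt0 lt_r er' lt_r' step.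
have -> : (r' < p)%N = (r < p)%N by case: ifP step; lia.
by case: (ltnP r p) => /= H; (split; first by []); case: ifP step; lia.
Qed.

Lemma det1_coprime (p q p1 q1 : nat) : (p * q1 = p1 * q + 1)%N -> coprime p q.
Proof.
move=> e; rewrite /coprime -dvdn1.
rewrite -(@dvdn_addr (p1 * q)) ?dvdn_mull ?dvdn_gcdr //.
by rewrite -e dvdn_mulr ?dvdn_gcdl.
Qed.

(** The perturbation of the deviation is m - 1 in the first part and 2d - m + 1 in the second;
    either equals d only at m = d + 1. *)
Lemma code_mediant (p1 q1 p2 q2 m : nat) :
  (p2 * q1 = p1 * q2 + 1)%N ->
  (0 < m <= (p1 + p2 + (q1 + q2)).*2)%N -> m != (p1 + p2 + (q1 + q2)).+1 ->
  code (p1 + p2) (q1 + q2) m =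
  if (m <= (p1 + q1).*2)%N then code p1 q1 m
  else code p2 q2 (m - (p1 + q1).*2).
Proof.
move=> det /andP[m_gt0 le_m] /eqP m_neq.
have [p2_gt0 q1_gt0] : (0 < p2)%N /\ (0 < q1)%N by nia.
rewrite /code; case: ifP => H.
  have [|-> e] := @dev_mediantl p1 q1 p2 q2 m det; first by lia.
  rewrite (@sign_perturb (p1 + q1)%:Z (p1 + p2 + (q1 + q2))%:Z _
             (dev p1 q1 m).2 (m%:Z - 1)) //.
  - by apply/andP; lia.
  - by apply/andP; lia.
  - by rewrite e addrA.
  - by apply/eqP; lia.
have [m' em] : exists m', m = ((p1 + q1).*2 + m')%N.
  by exists (m - (p1 + q1).*2)%N; lia.
rewrite em addKn; rewrite em in le_m m_neq H.
have [|-> e] := @dev_mediantr p1 q1 p2 q2 m' det; first by lia.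
rewrite (@sign_perturb (p2 + q2)%:Z (p1 + p2 + (q1 + q2))%:Z _
           (dev p2 q2 m').2 ((p2 + q2).*2%:Z - m'%:Z + 1)) //.
- by apply/andP; lia.
- by apply/andP; lia.
- by rewrite e !addrA.
- by apply/eqP; lia.
Qed.

(* The index of the Markov label attached to [p/q]. *)
Definition parity_letter (p q : nat) : letter :=
  if ~~ odd p then Lx else if odd q then Ly else Lz.

(** The index p + q + 1 is its own opposite, so its deviation vanishes, and each letter's formula
    can vanish for one parity class only. *)
Lemma dev_center (p q : nat) : coprime p q -> (0 < p)%N -> (0 < q)%N ->
  dev p q (p + q).+1 = (parity_letter p q, 0).
Proof.
move=> co p_gt0 q_gt0.
have [|||_ e] := @dev_opp p q (p + q).+1 (p + q).+1 co p_gt0; [lia|lia|lia|].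
have e0 : (dev p q (p + q).+1).2 = 0 by lia.
rewrite [LHS]surjective_pairing e0; congr (_, _).
have npq : odd p || odd q.
  apply: contraLR co; rewrite negb_or => /andP[op oq].
  apply/negP => /eqP e2.
  have : (2 %| gcdn p q)%N by rewrite dvdn_gcd !dvdn2 op oq.
  by rewrite e2.
move: e0; rewrite /dev /parity_letter.
case: ifP => /= o.
  by move: npq o; rewrite oddD; case: (odd p); case: (odd q).
case: ifP => /= _ e0.
  by have -> : ~~ odd p by lia.
have oq : odd q = false by lia.
by move: npq; rewrite oq orbF => ->.
Qed.

(** At the centre the perturbation is exactly d, so deviation 0 in the mediant comes from deviation
    -1 in a parent, and the exponent flips. *)
Lemma code_center (p1 q1 p2 q2 : nat) :
  (p2 * q1 = p1 * q2 + 1)%N ->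
  let d := (p1 + p2 + (q1 + q2))%N in
  let l := parity_letter (p1 + p2) (q1 + q2) in
  code (p1 + p2) (q1 + q2) d.+1 = (l, false) /\
  (if (d.+1 <= (p1 + q1).*2)%N then code p1 q1 d.+1
   else code p2 q2 (d.+1 - (p1 + q1).*2)) = (l, true).
Proof.
move=> det d l.
have [p2_gt0 q1_gt0] : (0 < p2)%N /\ (0 < q1)%N by nia.
have co : coprime (p1 + p2) (q1 + q2).
  by apply: (@det1_coprime _ _ p1 q1); lia.
have ec : dev (p1 + p2) (q1 + q2) d.+1 = (l, 0) by apply: dev_center => //; lia.
rewrite /code ec; split=> //; case: ifP => H.
  have [|] := @dev_mediantl p1 q1 p2 q2 d.+1 det; first by lia.
  by rewrite ec /= => <- e; congr (_, _); rewrite -/d in e; nia.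
have [m' em] : exists m', d.+1 = ((p1 + q1).*2 + m')%N.
  by exists (d.+1 - (p1 + q1).*2)%N; lia.
rewrite em addKn; have [|] := @dev_mediantr p1 q1 p2 q2 m' det; first by lia.
by rewrite -em ec /= => <- e; congr (_, _); rewrite -/d in e; nia.
Qed.

(** The factors need not commute: the inner products collapse first, which brings the outermost pair
    together. The central index a + k is skipped. *)
Lemma prod_palindrome (R : pzRingType) (F : nat -> R) (k a : nat) :
  (forall i, (i < k)%N -> F (a + i)%N * F (a + k.*2 - i)%N = 1) ->
  (\prod_(a <= m < a + k) F m) * (\prod_(a + k.+1 <= m < a + k.*2.+1) F m) = 1.
Proof.
elim: k a => [|k IHk] a H.
  by rewrite !big_geq ?mulr1 //; lia.
rewrite big_ltn; last by lia.
have -> : (a + k.+1.*2.+1 = (a + k.+1.*2).+1)%N by lia.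
rewrite [X in _ * X]big_nat_recr /=; last by lia.
rewrite mulrA -[X in X * _]mulrA.
have -> : (\prod_(a.+1 <= i < a + k.+1) F i) * (\prod_(a + k.+2 <= i < a + k.+1.*2) F i) = 1.
  have := IHk a.+1.
  have -> : (a.+1 + k = a + k.+1)%N by lia.
  have -> : (a.+1 + k.+1 = a + k.+2)%N by lia.
  have -> : (a.+1 + k.*2.+1 = a + k.+1.*2)%N by lia.
  apply=> i lt_i.
  have -> : (a.+1 + i = a + i.+1)%N by lia.
  have -> : (a.+1 + k.*2 - i = a + k.+1.*2 - i.+1)%N by lia.
  by apply: H; lia.
by rewrite mulr1; have := H 0%N isT; rewrite addn0 subn0.
Qed.

(** * Matrices of the letters *)

Lemma mx2M (a b c d a' b' c' d' : int) :
  mx2 a b c d *m mx2 a' b' c' d' =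
  mx2 (a * a' + b * c') (a * b' + b * d') (c * a' + d * c') (c * b' + d * d').
Proof.
apply/matrixP => i j; rewrite !mxE !big_ord_recl big_ord0 !mxE /= addr0.
by case: i => [[|[|i]] ?] //; case: j => [[|[|j]] ?].
Qed.

Lemma mx2B (a b c d a' b' c' d' : int) :
  mx2 a b c d - mx2 a' b' c' d' = mx2 (a - a') (b - b') (c - c') (d - d').
Proof.
apply/matrixP => i j; rewrite !mxE /=.
by case: i => [[|[|i]] ?] //; case: j => [[|[|j]] ?].
Qed.

Lemma mx2_scalar (a : int) : a%:M = mx2 a 0 0 a.
Proof.
apply/matrixP => i j; rewrite !mxE /=.
by case: i => [[|[|i]] ?] //; case: j => [[|[|j]] ?].
Qed.

Definition letter_k (k1 k2 k3 : nat) (s : 'S_3) (l : letter) : nat :=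
  match l with
  | Lx => kk k1 k2 k3 (s1 s)
  | Ly => kk k1 k2 k3 (s2 s)
  | Lz => kk k1 k2 k3 (s3 s)
  end.

(** The last clause is Cayley-Hamilton in determinant 1. *)
Lemma mx2_inv (a b c d : int) : a * d - b * c = 1 ->
  [/\ mx2 a b c d \in unitmx, invmx (mx2 a b c d) = mx2 d (- b) (- c) a &
      invmx (mx2 a b c d) = (a + d)%:M - mx2 a b c d].
Proof.
move=> e.
have e1 : mx2 a b c d *m mx2 d (- b) (- c) a = 1%:M.
  by rewrite mx2M mx2_scalar; congr mx2; lia.
have [u _] := mulmx1_unit e1.
have e2 : invmx (mx2 a b c d) = mx2 d (- b) (- c) a by rewrite -[LHS]mulmx1 -e1 mulKmx.
by split=> //; rewrite e2 mx2_scalar mx2B; congr mx2; lia.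
Qed.

(** Each letter matrix has determinant 1 and trace -k. *)
Lemma letter_mxV (k1 k2 k3 : nat) (s : 'S_3) (l : letter) :
  letter_mx k1 k2 k3 s (l, true) \in unitmx /\
  letter_mx k1 k2 k3 s (l, false) =
  - (letter_k k1 k2 k3 s l)%:Z%:M - letter_mx k1 k2 k3 s (l, true).
Proof.
by case: l; rewrite /letter_mx /= /Xmx /Ymx /Zmx;
  match goal with |- context [mx2 ?a ?b ?c ?d] =>
    have [|u _ ->] := @mx2_inv a b c d; first lia end;
  split=> //; congr (_ - _); rewrite -raddfN /=; congr (_%:M); lia.
Qed.

Lemma letter_mxN (k1 k2 k3 : nat) (s : 'S_3) (l : letter) (b : bool) :
  letter_mx k1 k2 k3 s (l, b) *m letter_mx k1 k2 k3 s (l, ~~ b) = 1%:M.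
Proof.
have [u _] := letter_mxV k1 k2 k3 s l.
by case: b; rewrite /letter_mx /= ?mulmxV ?mulVmx.
Qed.

(* The letters are numbered from 0; the product over [1 .. 2 (p + q)] moves the
   initial letter x to the end, and also makes sense for 0/1 and 1/0. *)
Definition Wmx (k1 k2 k3 : nat) (s : 'S_3) (p q : nat) : 'M[int]_2 :=
  \prod_(1 <= m < (p + q).*2.+1) letter_mx k1 k2 k3 s (code p q m).

(** The value of the product A B without the central letter: only the letters 1, 2 and 2(p + q)
    survive the cancellation. *)
Definition YZXmx (k1 k2 k3 : nat) (s : 'S_3) : 'M[int]_2 :=
  Ymx k1 k2 k3 s *m Zmx k1 k2 k3 s *m Xmx k1 k2 k3 s.

(** The completed word stops at index 2(p + q) - 1; by periodicity of the residue, the next index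
    repeats the initial x. *)
Lemma code_ends (p q : nat) : (0 < p)%N -> (0 < q)%N ->
  [/\ code p q 0 = (Lx, true), code p q 1 = (Ly, true), code p q 2 = (Lz, true)
    & code p q (p + q).*2 = (Lx, true)].
Proof.
move=> p_gt0 q_gt0.
have lt_p : (p < p + q)%N by lia.
have r0 : resid p q 0 = 0%N by rewrite /resid muln0 mod0n.
have r1 : resid p q 1 = p by rewrite /resid muln1 modn_small.
have rd : resid p q (p + q) = 0%N by rewrite /resid modnMl.
rewrite /code /dev odd_double doubleK /= r0 r1 rd p_gt0 ltnn /=.
by split; congr (_, _); lia.
Qed.

(** A zero deviation would be coded as l^-1 at both opposite places and prevent their cancellation.
    It would make d divide a perturbation strictly between 0 and 2d, which happens only at the
    centre. *)
Lemma dev_mediant_neq0 (p1 q1 p2 q2 m : nat) :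
  (p2 * q1 = p1 * q2 + 1)%N ->
  (1 < m < (p1 + p2 + (q1 + q2)).*2.+1)%N -> m != (p1 + p2 + (q1 + q2)).+1 ->
  (dev (p1 + p2) (q1 + q2) m).2 != 0.
Proof.
move=> det /andP[m_gt1 lt_m] /eqP m_neq; apply/eqP => e0.
have absurd (c : nat) B : (p1 + p2 + (q1 + q2))%:Z * B + c%:Z = 0 ->
    (0 < c < (p1 + p2 + (q1 + q2)).*2)%N -> c = (p1 + p2 + (q1 + q2))%N.
  move=> e /andP[c_gt0 lt_c].
  have [B0|[B1|B2]] : 0 <= B \/ B = -1 \/ B <= -2 by lia.
  - by nia.
  - by rewrite B1 in e; lia.
  by nia.
have [le_m|lt_m1] := leqP m (p1 + q1).*2.
  have [|_] := @dev_mediantl p1 q1 p2 q2 m det; first by lia.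
  by rewrite e0 mulr0 => e; have := absurd m.-1 (dev p1 q1 m).2; lia.
have [m' em] : exists m', m = ((p1 + q1).*2 + m')%N.
  by exists (m - (p1 + q1).*2)%N; lia.
have [|_] := @dev_mediantr p1 q1 p2 q2 m' det; first by lia.
rewrite -em e0 mulr0 => e.
by have := absurd ((p2 + q2).*2.+1 - m')%N (dev p2 q2 m').2; lia.
Qed.

Lemma Wmx_mediant (k1 k2 k3 : nat) (s : 'S_3) (p1 q1 p2 q2 : nat) :
  (p2 * q1 = p1 * q2 + 1)%N ->
  Wmx k1 k2 k3 s (p1 + p2) (q1 + q2) =
  - (Wmx k1 k2 k3 s p1 q1 *m Wmx k1 k2 k3 s p2 q2)
  - (letter_k k1 k2 k3 s (parity_letter (p1 + p2) (q1 + q2)))%:Z%:M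
    *m YZXmx k1 k2 k3 s.
Proof.
move=> det; set p := (p1 + p2)%N; set q := (q1 + q2)%N.
have [p2_gt0 q1_gt0] : (0 < p2)%N /\ (0 < q1)%N by nia.
have [p_gt0 q_gt0] : (0 < p)%N /\ (0 < q)%N by rewrite /p /q; lia.
have co : coprime p q by apply: (@det1_coprime _ _ p1 q1); rewrite /p /q; lia.
pose L := letter_mx k1 k2 k3 s.
pose c m := if (m <= (p1 + q1).*2)%N then code p1 q1 m
            else code p2 q2 (m - (p1 + q1).*2).
pose A := \prod_(1 <= m < (p + q).+1) L (code p q m).
pose B := \prod_((p + q).+2 <= m < (p + q).*2.+1) L (code p q m).
have [ec ec'] := code_center det; set l := parity_letter _ _ in ec ec' *.
have W12 : Wmx k1 k2 k3 s p1 q1 * Wmx k1 k2 k3 s p2 q2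
    = \prod_(1 <= m < (p + q).*2.+1) L (c m).
  rewrite (@big_cat_nat _ _ _ (p1 + q1).*2.+1) /=; [|lia|rewrite /p /q; lia].
  congr (_ * _).
    by rewrite /Wmx [LHS]big_nat [RHS]big_nat; apply: eq_bigr => m /andP[_ H];
       rewrite /c -ltnS H.
  rewrite -[(p1 + q1).*2.+1]add1n big_addn.
  have -> : ((p + q).*2.+1 - (p1 + q1).*2 = (p2 + q2).*2.+1)%N by rewrite /p /q; lia.
  rewrite /Wmx [LHS]big_nat [RHS]big_nat; apply: eq_bigr => m /andP[H _].
  by rewrite /c addnK ifN //; lia.
have W12E : Wmx k1 k2 k3 s p1 q1 * Wmx k1 k2 k3 s p2 q2 = A * L (l, true) * B.
  rewrite W12 (@big_cat_nat _ _ _ (p + q).+1) /=; [|lia|lia].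
  rewrite [X in _ * X]big_ltn; last by lia.
  rewrite mulrA /A /B; congr (_ * _ * _).
  - rewrite [LHS]big_nat [RHS]big_nat; apply: eq_bigr => m /andP[H1 H2].
    by rewrite code_mediant //; rewrite /p /q in H2; lia.
  - by rewrite /c /p /q addnACA in ec' *; rewrite ec'.
  rewrite [LHS]big_nat [RHS]big_nat; apply: eq_bigr => m /andP[H1 H2].
  by rewrite code_mediant //; rewrite /p /q in H1 H2; lia.
have WE : Wmx k1 k2 k3 s p q = A * L (l, false) * B.
  rewrite /Wmx (@big_cat_nat _ _ _ (p + q).+1) /=; [|lia|lia].
  rewrite [X in _ * X]big_ltn; last by lia.
  by rewrite mulrA ec.
have AB : A * B = YZXmx k1 k2 k3 s.
  have [_ e1 e2 e3] := code_ends p_gt0 q_gt0.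
  rewrite /A big_ltn; last by lia.
  rewrite big_ltn; last by lia.
  rewrite /B [X in _ * X]big_nat_recr /=; last by lia.
  rewrite e1 e2 e3 -!mulrA [X in _ * (_ * X)]mulrA.
  (* The indices 3 to 2(p + q) - 1 cancel in pairs around 3 + (p + q - 2) = p + q + 1, the central
     letter, absent from A and B. *)
  have := @prod_palindrome _ (fun m => L (code p q m)) (p + q - 2) 3.
  have -> : (3 + (p + q - 2) = (p + q).+1)%N by lia.
  have -> : (3 + (p + q - 2).+1 = (p + q).+2)%N by lia.
  have -> : (3 + (p + q - 2).*2.+1 = (p + q).*2)%N by lia.
  move=> ->; first by rewrite mul1r mulrA.
  move=> i lt_i.
  have [|||El Ed] := @dev_opp p q (3 + i) (3 + (p + q - 2).*2 - i) co p_gt0; [lia|lia|lia|].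
  have dn0 : (dev p q (3 + i)).2 != 0.
    by apply: dev_mediant_neq0 => //; rewrite -/p -/q; lia.
  rewrite /code El Ed.
  have -> : (- (dev p q (3 + i)).2 < 0) = ~~ ((dev p q (3 + i)).2 < 0).
    by lia.
  exact: letter_mxN.
rewrite WE /L; have [_ ->] := letter_mxV k1 k2 k3 s l.
rewrite -/L -[_ *m Wmx _ _ _ _ _ _]/(_ * _) W12E -AB.
rewrite mulrBr mulrBl addrC; congr (_ + _).
by rewrite mulrN mulNr mul_scalar_mx -scalemx1 -scalerAr mulr1 -scalerAl.
Qed.

Lemma bigK_perm (k1 k2 k3 : nat) (s : 'S_3) :
  bigK k1 k2 k3 =
  (3 + kk k1 k2 k3 (s1 s) + kk k1 k2 k3 (s2 s) + kk k1 k2 k3 (s3 s))%N%:Z.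
Proof.
have E (F : 'I_3 -> nat) : (\sum_i F i = F ord0 + F (inord 1) + F (inord 2))%N.
  rewrite !big_ord_recl big_ord0 addn0 addnA.
  by congr (_ + F _ + F _)%N; apply: val_inj; rewrite /= inordK.
have : (\sum_i kk k1 k2 k3 i = \sum_i kk k1 k2 k3 (s i))%N.
  exact: reindex_inj (@perm_inj _ s).
rewrite !E /s1 /s2 /s3 {1 2 3}/kk !inordK //= => e.
by rewrite /bigK; lia.
Qed.

Definition cohn_of (k1 k2 k3 : nat) (s : 'S_3) (W : 'M[int]_2) : 'M[int]_2 :=
  mx2 (-1) 0 0 1 *m (Xmx k1 k2 k3 s *m W *m invmx (Xmx k1 k2 k3 s))
  *m mx2 1 0 0 (-1).

Lemma Xmx_inv (k1 k2 k3 : nat) (s : 'S_3) :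
  Xmx k1 k2 k3 s \in unitmx /\
  invmx (Xmx k1 k2 k3 s) = mx2 0 1 (-1) (- (kk k1 k2 k3 (s1 s))%:Z).
Proof.
rewrite /Xmx; match goal with |- context [mx2 ?a ?b ?c ?d] =>
    have [|u -> _] := @mx2_inv a b c d; first lia end.
by split=> //; congr mx2; lia.
Qed.

(** Conjugation by X turns Y Z X into X Y Z, which the sign matrices send to the unipotent matrix
    with upper right entry K; k times it is [Dmx]. *)
Lemma cohn_mediant (k1 k2 k3 : nat) (s : 'S_3) (p1 q1 p2 q2 : nat) :
  (p2 * q1 = p1 * q2 + 1)%N ->
  cohn_of k1 k2 k3 s (Wmx k1 k2 k3 s (p1 + p2) (q1 + q2)) =
  cohn_of k1 k2 k3 s (Wmx k1 k2 k3 s p1 q1)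
    *m cohn_of k1 k2 k3 s (Wmx k1 k2 k3 s p2 q2)
  - Dmx k1 k2 k3 (letter_k k1 k2 k3 s (parity_letter (p1 + p2) (q1 + q2))).
Proof.
move=> det; rewrite Wmx_mediant //.
move: (letter_k _ _ _ _ _) (Wmx _ _ _ _ p1 q1) (Wmx _ _ _ _ p2 q2) => k W1 W2.
have [uX eX] := Xmx_inv k1 k2 k3 s.
rewrite /cohn_of mulmxBr mulmxBl mulmxBr mulmxBl; congr (_ - _).
  (* The sign matrices meeting between the two factors give -1, which absorbs the sign of - W1
     W2. *)
  have JJ : mx2 1 0 0 (-1) *m mx2 (-1) 0 0 1 = - 1%:M.
    by rewrite mx2M mx2_scalar -[RHS]add0r -(subrr (mx2 0 0 0 0)) !mx2B.
  rewrite !mulmxA -[in RHS](mulmxA _ (mx2 1 0 0 (-1)) (mx2 (-1) 0 0 1)) JJ.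
  by rewrite !(mulmxN, mulNmx) mulmx1 !mulmxA mulmxKV.
rewrite eX /YZXmx /Xmx /Ymx /Zmx /Dmx (bigK_perm k1 k2 k3 s) mx2_scalar !mx2M.
by congr mx2; rewrite ?PoszD; ring.
Qed.

Lemma cohn_roots (k1 k2 k3 : nat) (s : 'S_3) :
  [/\ cohn_of k1 k2 k3 s (Wmx k1 k2 k3 s 0 1) = C01 k1 k2 k3 s,
      cohn_of k1 k2 k3 s (Wmx k1 k2 k3 s 1 1) = C11 k1 k2 k3 s &
      cohn_of k1 k2 k3 s (Wmx k1 k2 k3 s 1 0) = C10 k1 k2 k3 s].
Proof.
have [uX eX] := Xmx_inv k1 k2 k3 s.
have E01 : cohn_of k1 k2 k3 s (Wmx k1 k2 k3 s 0 1) = C01 k1 k2 k3 s.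
  have -> : Wmx k1 k2 k3 s 0 1 = Ymx k1 k2 k3 s *m Zmx k1 k2 k3 s.
    by rewrite /Wmx unlock /= mulr1.
  rewrite /cohn_of eX /C01 (bigK_perm k1 k2 k3 s) /Xmx /Ymx /Zmx !mx2M.
  by congr mx2; rewrite ?PoszD; ring.
have E10 : cohn_of k1 k2 k3 s (Wmx k1 k2 k3 s 1 0) = C10 k1 k2 k3 s.
  have -> : Wmx k1 k2 k3 s 1 0 = Ymx k1 k2 k3 s *m Xmx k1 k2 k3 s.
    by rewrite /Wmx unlock /= mulr1.
  rewrite /cohn_of eX /C10 (bigK_perm k1 k2 k3 s) /Xmx /Ymx !mx2M.
  by congr mx2; rewrite ?PoszD; ring.
(* The fraction 1/1 is handled as the mediant of 0/1 and 1/0, whose products have two letters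
   each. *)
split=> //; rewrite -[X in Wmx _ _ _ _ X 1]/(0 + 1)%N -[X in Wmx _ _ _ _ _ X]/(1 + 0)%N.
rewrite cohn_mediant // E01 E10 /C01 /C10 /C11 /Dmx (bigK_perm k1 k2 k3 s) !mx2M mx2B.
by congr mx2; rewrite ?PoszD /=; ring.
Qed.

(** * Induction over the trees *)

(** Reading k off the parities of numerator and denominator makes it depend on the rational
    alone. *)
Definition Cohn_invariant (k1 k2 k3 : nat) (s : 'S_3)
    (v : Defs.frac * Defs.frac * Defs.frac) (st : Cstate) : Prop :=
  let: (r, t, u) := v in
  let: (((_, ir), (_, it), (_, iu)), (Cr, Ct, Cu)) := st in
  let label (x : Defs.frac) i :=
    kk k1 k2 k3 i = letter_k k1 k2 k3 s (parity_letter x.1 x.2) in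
  let cohn (x : Defs.frac) C := C = cohn_of k1 k2 k3 s (Wmx k1 k2 k3 s x.1 x.2) in
  [/\ t = mediant r u, (u.1 * r.2 = r.1 * u.2 + 1)%N,
      [/\ label r ir, label t it & label u iu] &
      [/\ cohn r Cr, cohn t Ct & cohn u Cu]].

Lemma Cohn_invariantP (k1 k2 k3 : nat) (s : 'S_3) (w : seq bool) :
  Cohn_invariant k1 k2 k3 s (FT_vertex w) (C_vertex k1 k2 k3 s w).
Proof.
elim/last_ind: w => [|w b IHw].
  by have [e1 e2 e3] := cohn_roots k1 k2 k3 s; split.
rewrite /FT_vertex /C_vertex !foldl_rcons -/(FT_vertex w) -/(C_vertex k1 k2 k3 s w).
case: (FT_vertex w) IHw => [[[a b1] t] [c d]].
case: (C_vertex _ _ _ _ w) => [[[[m ir] [m' it]] [m'' iu]] [[Cr Ct] Cu]] [-> /= det].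
move=> [lr lt lu] [er et eu].
(* The new mediant, 2r + u or r + 2u, has the parity class of the outer fraction being dropped,
   whose label it inherits and whose D is subtracted. *)
have par x y z u : parity_letter (x + y.*2) (z + u.*2) = parity_letter x z.
  by rewrite /parity_letter !oddD !odd_double !addbF.
have parr := par a c b1 d; have parl := par c a d b1.
have eparr : parity_letter (a + c + c) (b1 + d + d) = parity_letter a b1.
  by rewrite -parr -!addnA !addnn.
have eparl : parity_letter (a + (a + c)) (b1 + (b1 + d)) = parity_letter c d.
  by rewrite -parl !addnA !addnn addnC [(b1.*2 + d)%N]addnC.
have det_l : ((a + c) * b1 = a * (b1 + d) + 1)%N by lia.
have det_r : (c * (b1 + d) = (a + c) * d + 1)%N by lia.
case: b => /=; split=> //.
- by split; rewrite ?eparr.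
- by split=> //; rewrite cohn_mediant // eparr et eu lr.
- by split; rewrite ?eparl.
- by split=> //; rewrite cohn_mediant // eparl er et lu.
Qed.

(** Subtractive Euclid on the coefficients: for a < b, a r + b u = a (r + u) + (b - a) u is sought
    below the right child, and symmetrically. Coprimality ends the descent at a = b = 1. *)
Lemma FT_vertex_reach (w : seq bool) (r t u : Defs.frac) (a b : nat) :
  FT_vertex w = (r, t, u) -> t = mediant r u -> (0 < a)%N -> (0 < b)%N ->
  coprime a b -> exists w', FT_mid w' = (a * r.1 + b * u.1, a * r.2 + b * u.2)%N.
Proof.
have [n] := ubnP (a + b); elim: n => // n IHn in w r t u a b *.
move=> le_n ew et a_gt0 b_gt0 co.
have [lt_ab|lt_ba|eab] := ltngtP a b.
- have [||||||w' ew'] := IHn (rcons w true) t (mediant t u) u a (b - a)%N.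
  + by lia.
  + by rewrite /FT_vertex foldl_rcons -/(FT_vertex w) ew.
  + by [].
  + by [].
  + by lia.
  + by rewrite /coprime -(gcdnDl a (b - a)) subnKC // ltnW.
  exists w'; rewrite ew' et; congr (_, _) => /=; move: (subnKC (ltnW lt_ab)).
  + by move: (b - a)%N => c <-; lia.
  by move: (b - a)%N => c <-; lia.
- have [||||||w' ew'] := IHn (rcons w false) r (mediant r t) t (a - b)%N b.
  + by lia.
  + by rewrite /FT_vertex foldl_rcons -/(FT_vertex w) ew.
  + by [].
  + by lia.
  + by [].
  + by rewrite /coprime gcdnC -(gcdnDl b (a - b)) subnKC 1?gcdnC // ltnW.
  exists w'; rewrite ew' et; congr (_, _) => /=; move: (subnKC (ltnW lt_ba)).
  + by move: (a - b)%N => c <-; lia.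
  by move: (a - b)%N => c <-; lia.
move: co; rewrite eab /coprime gcdnn => /eqP ->.
by exists w; rewrite /FT_mid ew et /= /mediant !mul1n.
Qed.

Lemma FT_mid_surj (p q : nat) : (0 < p)%N -> (0 < q)%N -> coprime p q ->
  exists w, FT_mid w = (p, q).
Proof.
move=> p_gt0 q_gt0; rewrite coprime_sym => co.
have [w ew] := @FT_vertex_reach [::] (0, 1)%N (1, 1)%N (1, 0)%N q p erefl erefl
  q_gt0 p_gt0 co.
by exists w; rewrite ew /= !muln0 !muln1 addn0.
Qed.

Lemma Mbar_cohn (k1 k2 k3 : nat) (s : 'S_3) (p q : nat) :
  (0 < p)%N -> (0 < q)%N -> omega_bar p q = mkseq (code p q) (p + q).*2 ->
  mx2 (-1) 0 0 1 *m Mbar k1 k2 k3 s p q *m mx2 1 0 0 (-1) =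
  cohn_of k1 k2 k3 s (Wmx k1 k2 k3 s p q).
Proof.
move=> p_gt0 q_gt0 e; have [e0 _ _ e1] := code_ends p_gt0 q_gt0.
have [uX _] := Xmx_inv k1 k2 k3 s.
pose F m := letter_mx k1 k2 k3 s (code p q m).
have ME : Mbar k1 k2 k3 s p q = \prod_(0 <= m < (p + q).*2) F m.
  rewrite /Mbar e /mkseq /index_iota subn0.
  by elim: (iota _ _) => [|m l IHl] /=; rewrite ?big_nil // big_cons IHl.
(* Splitting off the first or the last factor, both equal to X, gives X W = Mbar X. *)
have := erefl (\prod_(0 <= m < (p + q).*2.+1) F m).
rewrite {1}big_ltn // [RHS]big_nat_recr //= -ME /F e0 e1 => XW.
by rewrite /cohn_of [X in _ *m (X *m _)]XW -[_ * _]/(_ *m _) mulmxK.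
Qed.

(** * Geometry of the shifted segment *)

(** With known infinitesimal parts, a comparison becomes one rational inequality, whose strictness
    they decide. *)
Lemma eleE (u v : epsr) :
  ele u v = if u.2 <= v.2 then u.1 <= v.1 else u.1 < v.1.
Proof. by rewrite /ele; case: ifP => _; rewrite ?andbT ?andbF ?orbF // le_eqVlt orbC. Qed.

Lemma eltE (u v : epsr) :
  elt u v = if u.2 < v.2 then u.1 <= v.1 else u.1 < v.1.
Proof. by rewrite /elt; case: ifP => _; rewrite ?andbT ?andbF ?orbF // le_eqVlt orbC. Qed.

(** The shift moves the crossing towards the initial vertex of the edge, so 0 is excluded and p
    included for q j - p i. *)
Lemma crossing_x (p q : nat) (i j : int) : (0 < p)%N -> (0 < q)%N ->
  crossing p q ((i%:~R, j%:~R), (1, 0), Lx) =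
  if [&& 0 <= j, j < p%:Z, 0 < q%:Z * j - p%:Z * i & q%:Z * j - p%:Z * i <= p%:Z]
  then Some ((j%:~R / p%:R, 0), (Lx, p%:Z < 2 * (q%:Z * j - p%:Z * i))) else None.
Proof.
move=> p_gt0 q_gt0.
have pR : 0 < p%:R :> rat by rewrite ltr0n.
have p0 : p%:R != 0 :> rat by rewrite gt_eqF.
have E : (q%:Z * j - p%:Z * i)%:~R = q%:R * j%:~R - p%:R * i%:~R :> rat.
  by rewrite rmorphB !rmorphM.
rewrite /crossing /=; set lam := eZ _ (eD _ (eZ (- 1) _)); set mu := eZ _ (eD (eZ p%:R _) _).
set side := eD _ _.
have -> : lam = (j%:~R / p%:R, 0).
  by congr (_, _); rewrite /=; field.
have -> : mu = ((q%:Z * j - p%:Z * i)%:~R / p%:R, -1).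
  by rewrite E; congr (_, _); rewrite /=; field.
have -> : side = ((q%:Z * j - p%:Z * i)%:~R - p%:R / 2, - p%:R).
  by rewrite E; congr (_, _); rewrite /=; field.
rewrite !(eleE, eltE) /= oppr_lt0 pR -ltNge subr_gt0.
rewrite !pmulr_lge0 ?pmulr_lgt0 ?invr_gt0 // ler_pdivrMr // !ltr_pdivrMr // !mul1r.
by rewrite [_ * 2]mulrC -[2]/(2%:~R) -rmorphM pmulrn !ltr_int !ler_int ler0z ltr0z.
Qed.

(** Here the shift moves the crossing away from the initial vertex, so the half-open interval is
    reversed. *)
Lemma crossing_z (p q : nat) (i j : int) : (0 < p)%N -> (0 < q)%N ->
  crossing p q ((i%:~R, j%:~R), (0, 1), Lz) =
  if [&& 0 <= i, i < q%:Z, 0 <= p%:Z * i - q%:Z * j & p%:Z * i - q%:Z * j < q%:Z]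
  then Some ((i%:~R / q%:R, q%:R^-1), (Lz, 2 * (p%:Z * i - q%:Z * j) < q%:Z))
  else None.
Proof.
move=> p_gt0 q_gt0.
have pR : 0 < p%:R :> rat by rewrite ltr0n.
have qR : 0 < q%:R :> rat by rewrite ltr0n.
have q0 : q%:R != 0 :> rat by rewrite gt_eqF.
have E : (p%:Z * i - q%:Z * j)%:~R = p%:R * i%:~R - q%:R * j%:~R :> rat.
  by rewrite rmorphB !rmorphM.
rewrite /crossing /=; set lam := eZ _ (eD _ (eZ (- 0) _)); set mu := eZ _ (eD (eZ p%:R _) _).
set side := eD _ _.
have -> : lam = (i%:~R / q%:R, q%:R^-1).
  by congr (_, _); rewrite /=; field.
have -> : mu = ((p%:Z * i - q%:Z * j)%:~R / q%:R, p%:R / q%:R).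
  by rewrite E; congr (_, _); rewrite /=; field.
have -> : side = (q%:R / 2 - (p%:Z * i - q%:Z * j)%:~R, - p%:R).
  by rewrite E; congr (_, _); rewrite /=; field.
rewrite !(eleE, eltE) /= oppr_lt0 pR -ltNge subr_gt0.
have q_ge : (q%:R^-1 < 0 :> rat) = false by apply/negbTE; rewrite -leNgt ltW ?invr_gt0.
have pq_ge : (p%:R / q%:R <= 0 :> rat) = false.
  by apply/negbTE; rewrite -ltNge divr_gt0.
have q_le : (0 <= q%:R^-1 :> rat) by rewrite invr_ge0 ltW.
have pq_le : (0 <= p%:R / q%:R :> rat) by rewrite divr_ge0 ?ltW.
rewrite q_ge pq_ge q_le pq_le.
rewrite !pmulr_lge0 ?invr_gt0 // ltr_pdivlMr // !ltr_pdivrMr // !mul1r.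
by rewrite [_ * 2]mulrC -[2]/(2%:~R) -rmorphM pmulrn !ltr_int !ler0z.
Qed.

Lemma crossing_y (p q : nat) (i j : int) : (0 < p)%N -> (0 < q)%N ->
  crossing p q ((i%:~R, j%:~R), (1, -1), Ly) =
  if [&& 0 <= i + j, i + j < (p + q)%:Z, 0 < q%:Z * j - p%:Z * i
       & q%:Z * j - p%:Z * i <= (p + q)%:Z]
  then Some (((i + j)%:~R / (p + q)%:R, (p + q)%:R^-1),
             (Ly, (p + q)%:Z < 2 * (q%:Z * j - p%:Z * i)))
  else None.
Proof.
move=> p_gt0 q_gt0.
have pR : 0 < p%:R :> rat by rewrite ltr0n.
have qR : 0 < q%:R :> rat by rewrite ltr0n.
have dR : 0 < (p + q)%:R :> rat by rewrite ltr0n addn_gt0 p_gt0.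
have d0 : q%:R + p%:R != 0 :> rat by rewrite gt_eqF // addr_gt0.
have E : (q%:Z * j - p%:Z * i)%:~R = q%:R * j%:~R - p%:R * i%:~R :> rat.
  by rewrite rmorphB !rmorphM.
rewrite /crossing /=; set lam := eZ _ (eD _ (eZ (- 1) _)); set mu := eZ _ (eD (eZ p%:R _) _).
set side := eD _ _.
have d0' : p%:R + q%:R != 0 :> rat by rewrite addrC.
have -> : lam = ((i + j)%:~R / (p + q)%:R, (p + q)%:R^-1).
  by rewrite natrD rmorphD; congr (_, _); rewrite /=; field; rewrite d0'; lra.
have -> : mu = ((q%:Z * j - p%:Z * i)%:~R / (p + q)%:R, - (p%:R / (p + q)%:R)).
  by rewrite E natrD; congr (_, _); rewrite /=; field; rewrite d0'; lra.
have -> : side = ((q%:Z * j - p%:Z * i)%:~R - (p + q)%:R / 2, - p%:R).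
  by rewrite E natrD; congr (_, _); rewrite /=; field.
rewrite !(eleE, eltE) /= oppr_lt0 pR -ltNge subr_gt0.
have d_ge : ((p + q)%:R^-1 < 0 :> rat) = false by apply/negbTE; rewrite -leNgt ltW ?invr_gt0.
have d_le : (0 <= (p + q)%:R^-1 :> rat) by rewrite invr_ge0 ltW.
rewrite d_ge d_le.
have -> : (0 <= - (p%:R / (p + q)%:R) :> rat) = false.
  by apply/negbTE; rewrite -ltNge oppr_lt0 divr_gt0.
have -> : (- (p%:R / (p + q)%:R) <= 0 :> rat) by rewrite oppr_le0 divr_ge0.
rewrite !pmulr_lge0 ?pmulr_lgt0 ?invr_gt0 // ler_pdivrMr // !ltr_pdivrMr // !mul1r.
by rewrite [_ * 2]mulrC -[2]/(2%:~R) -rmorphM pmulrn !ltr_int !ler_int ler0z ltr0z.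
Qed.

(** Transports decidable equality to letters, hence to edges, as [uniq] and [perm_eq] require. *)
Definition letter_code (l : letter) : 'I_3 :=
  match l with Lx => inord 0 | Ly => inord 1 | Lz => inord 2 end.

Definition letter_decode (i : 'I_3) : letter :=
  match val i with 0%N => Lx | 1%N => Ly | _ => Lz end.

Lemma letter_codeK : cancel letter_code letter_decode.
Proof. by case; rewrite /letter_decode /= inordK. Qed.

HB.instance Definition _ := Equality.copy letter (can_type letter_codeK).

Definition height (p q n : nat) : nat := (p * n %/ (p + q))%N.

Lemma height_resid (p q n : nat) : (p * n = height p q n * (p + q) + resid p q n)%N.
Proof. exact: divn_eq. Qed.

(* The shifted segment meets the [n]-th antidiagonal inside the unit cell with
   lower left corner [(n - 1 - height n, height n)]. *)
Definition edge_at (p q m : nat) : edge :=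
  let n := m./2 in
  let i : int := n%:Z - 1 - (height p q n)%:Z in
  let j : int := (height p q n)%:Z in
  if odd m then ((i%:~R, (j + 1)%:~R), (1, -1), Ly)
  else if (resid p q n < p)%N then ((i%:~R, j%:~R), (1, 0), Lx)
  else ((i%:~R, j%:~R), (0, 1), Lz).

(** The infinitesimal part is 0 on horizontal edges, since the shift is parallel to them. *)
Definition time_at (p q m : nat) : epsr :=
  let n := m./2 in
  if odd m then (n%:R / (p + q)%:R, (p + q)%:R^-1)
  else if (resid p q n < p)%N then ((height p q n)%:R / p%:R, 0)
  else ((n%:Z - 1 - (height p q n)%:Z)%:~R / q%:R, q%:R^-1).

Lemma height_bounds (p q n : nat) : (0 < p)%N -> (0 < q)%N -> (n < p + q)%N ->
  [/\ (resid p q n < p + q)%N, (height p q n < p)%N, (height p q n <= n)%N &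
      (n <= height p q n + q)%N] /\
  ((p <= resid p q n)%N -> (height p q n < n)%N).
Proof.
move=> p_gt0 q_gt0 lt_n.
have lt_r : (resid p q n < p + q)%N by rewrite ltn_mod; lia.
have lt_f : (height p q n < p)%N.
  by rewrite /height ltn_divLR; [rewrite ltn_pmul2l|lia].
have := height_resid p q n.
move: (height _ _ _) (resid _ _ _) lt_r lt_f => f r lt_r lt_f e.
have le_f : (f <= n)%N by rewrite leqNgt; apply/negP => H; nia.
split; first (split=> //).
  rewrite leqNgt; apply/negP => H; nia.
by move=> le_p; rewrite ltnNge; apply/negP => H; nia.
Qed.

(** In the cell with i + j + 1 = n and j = [height], p i - q j = r - p, so the crossing conditions
    become r < p for x and p <= r < p + q for z. *)
Lemma crossing_edge_at (p q m : nat) :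
  (0 < p)%N -> (0 < q)%N -> (m < (p + q).*2)%N ->
  crossing p q (edge_at p q m) = Some (time_at p q m, code p q m).
Proof.
move=> p_gt0 q_gt0 lt_m; have lt_n : (m./2 < p + q)%N by lia.
have [[lt_r lt_f le_f le_n] pos_i] := height_bounds p_gt0 q_gt0 lt_n.
have e := height_resid p q m./2.
rewrite /edge_at /time_at /code /dev.
move: (height _ _ _) (resid _ _ _) lt_r lt_f le_f le_n pos_i e.
move=> f r lt_r lt_f le_f le_n pos_i e.
case: ifP => _.
  rewrite crossing_y // ifT /=; last by lia.
  have -> : (m./2%:Z - 1 - f%:Z + (f%:Z + 1))%R = m./2%:Z by lia.
  by congr (Some (_, (_, _))); lia.
case: ifP => [lt_p|/negbT].
  by rewrite crossing_x // ifT /=; [congr (Some (_, (_, _))); lia|lia].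
rewrite -leqNgt => le_p; have := pos_i le_p => {}pos_i.
by rewrite crossing_z // ifT /=; [congr (Some (_, (_, _))); lia|lia].
Qed.

(** Rational parts may tie, as they do at 0 for the first three letters; the order 0 < 1/(p + q) <
    1/q of the infinitesimal parts then decides. *)
Lemma time_at_lt (p q m : nat) :
  (0 < p)%N -> (0 < q)%N -> (m.+1 < (p + q).*2)%N ->
  elt (time_at p q m) (time_at p q m.+1).
Proof.
move=> p_gt0 q_gt0 lt_m.
have pR : 0 < p%:R :> rat by rewrite ltr0n.
have qR : 0 < q%:R :> rat by rewrite ltr0n.
have dR : 0 < (p + q)%:R :> rat by rewrite ltr0n addn_gt0 p_gt0.
have d_lt : (p + q)%:R^-1 < q%:R^-1 :> rat.
  by rewrite ltf_pV2 ?posrE // ltr_nat; lia.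
have dV : 0 < (p + q)%:R^-1 :> rat by rewrite invr_gt0.
have dV' := lt_gtF dV; have d_lt' := lt_gtF d_lt.
rewrite /time_at [odd m.+1]oddS; case: (boolP (odd m)) => odd_m.
  have -> : (m.+1./2 = m./2.+1)%N by lia.
  have lt_n : (m./2.+1 < p + q)%N by lia.
  have [[lt_r lt_f le_f le_n] _] := height_bounds p_gt0 q_gt0 lt_n.
  have e := height_resid p q m./2.+1.
  move: (height _ _ _) (resid _ _ _) lt_r lt_f le_f le_n e => f r lt_r lt_f le_f le_n e.
  case: ifP => H; rewrite eltE /=.
    rewrite dV' ltr_pdivrMr // mulrAC ltr_pdivlMr // -!natrM ltr_nat; lia.
  rewrite d_lt ler_pdivrMr // mulrAC ler_pdivlMr // !pmulrn -!rmorphM ler_int /=; lia.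
have -> : (m.+1./2 = m./2)%N by lia.
have lt_n : (m./2 < p + q)%N by lia.
have [[lt_r lt_f le_f le_n] _] := height_bounds p_gt0 q_gt0 lt_n.
have e := height_resid p q m./2.
move: (height _ _ _) (resid _ _ _) lt_r lt_f le_f le_n e => f r lt_r lt_f le_f le_n e.
case: ifP => H; rewrite eltE /=.
  rewrite dV ler_pdivrMr // mulrAC ler_pdivlMr // -!natrM ler_nat; lia.
rewrite d_lt' ltr_pdivrMr // mulrAC ltr_pdivlMr // !pmulrn -!rmorphM ltr_int /=; lia.
Qed.

(** * Ordering and enumeration of the crossings *)

Lemma ele_trans : transitive ele.
Proof.
move=> v u w; rewrite !eleE.
by case: (leP u.2 v.2); case: (leP v.2 w.2); case: (leP u.2 w.2); lra.
Qed.

Lemma ele_total : total ele.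
Proof. by move=> u v; rewrite !eleE; case: (ltgtP u.2 v.2); case: (ltgtP u.1 v.1). Qed.

Lemma ele_anti : antisymmetric ele.
Proof.
move=> [a b] [c d]; rewrite !eleE /= => /andP[].
case: (ltgtP b d) => [lt_bd|lt_bd|->] /=; case: (ltgtP a c) => //= -> //.
Qed.

Lemma elt_trans : transitive elt.
Proof.
move=> v u w; rewrite !eltE.
by case: (ltP u.2 v.2); case: (ltP v.2 w.2); case: (ltP u.2 w.2); lra.
Qed.

Lemma elt_irr : irreflexive elt.
Proof. by move=> u; rewrite eltE !ltxx. Qed.

Lemma elt_ele : subrel elt ele.
Proof.
move=> u v; rewrite eltE eleE; case: (ltgtP u.2 v.2) => //= _; exact: ltW.
Qed.

Lemma uniq_flatten_map (S T : eqType) (F : S -> seq T) (s : seq S) :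
  uniq s -> {in s, forall x, uniq (F x)} ->
  {in s &, forall x y z, z \in F x -> z \in F y -> x = y} ->
  uniq (flatten (map F s)).
Proof.
elim: s => //= x s IHs /andP[xs us] uF dF.
rewrite cat_uniq uF ?mem_head //= IHs //; first last.
- by move=> y z ys zs; apply: dF; rewrite in_cons ?ys ?zs orbT.
- by move=> y ys; apply: uF; rewrite in_cons ys orbT.
rewrite andbT; apply/hasPn => z /flatten_mapP[y ys zy].
apply: contra xs => zx.
by rewrite (dF x y _ _ z) ?mem_head // in_cons ys orbT.
Qed.

Lemma uniq_cand_edges (p q : nat) : uniq (cand_edges p q).
Proof.
have inj (a b : nat) : a%:R - 1 = b%:R - 1 :> rat -> a = b.
  by move=> /addIr /eqP; rewrite eqr_nat => /eqP.
apply: uniq_flatten_map => [|a _|a a' _ _ z]; first exact: iota_uniq.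
  apply: uniq_flatten_map => [|b _|b b' _ _ z]; first exact: iota_uniq.
    by rewrite /= !inE !andbT; apply/andP; split; apply/negP; first case/orP; move/eqP.
  rewrite !inE => /or3P[] /eqP -> /or3P[] /eqP [] //; first exact: inj.
    exact: inj.
  by move=> /addIr; exact: inj.
move=> /flatten_mapP[b _ H] /flatten_mapP[b' _ H']; apply: inj.
have E c d (e : edge) :
    e \in [:: ((c, d), (1, 0), Lx); ((c, d), (0, 1), Lz); ((c, d + 1), (1, -1), Ly)] ->
    e.1.1.1 = c.
  by rewrite !inE => /or3P[] /eqP ->.
by rewrite -(E _ _ _ H) -(E _ _ _ H').
Qed.

Lemma mem_cand_edges (p q : nat) (e : edge) :
  reflect (exists i j : int,
    [/\ -1 <= i <= q%:Z, -1 <= j <= p%:Z &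
        e \in [:: ((i%:~R, j%:~R), (1, 0), Lx); ((i%:~R, j%:~R), (0, 1), Lz);
                  ((i%:~R, (j + 1)%:~R), (1, -1), Ly)]])
  (e \in cand_edges p q).
Proof.
have E a : a%:R - 1 = (a%:Z - 1)%:~R :> rat by rewrite rmorphB.
have E1 (k : int) : (k + 1)%:~R = k%:~R + 1 :> rat by rewrite rmorphD.
apply: (iffP flatten_mapP) => [[a a_in /flatten_mapP[b b_in H]]|].
  exists (a%:Z - 1), (b%:Z - 1); rewrite !mem_iota in a_in b_in; split; [lia|lia|].
  by rewrite !E in H; rewrite E1.
move=> [i] [j] [i_b j_b H].
have [a ei] : exists a : nat, i = a%:Z - 1 by exists (absz (i + 1)); lia.
have [b ej] : exists b : nat, j = b%:Z - 1 by exists (absz (j + 1)); lia.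
exists a; first by rewrite mem_iota; lia.
apply/flatten_mapP; exists b; first by rewrite mem_iota; lia.
by rewrite !E -ei -ej /= -E1.
Qed.

(** Uniqueness of Euclidean division recovers the index of a crossed edge from its cell. *)
Lemma edge_at_cell (p q n : nat) (i j r : int) :
  i + j + 1 = n%:Z -> 0 <= r < (p + q)%:Z ->
  p%:Z * n%:Z = j * (p + q)%:Z + r ->
  [/\ (height p q n)%:Z = j, n%:Z - 1 - (height p q n)%:Z = i &
      (resid p q n)%:Z = r].
Proof.
move=> en /andP[r_ge0 lt_r] e.
have j_ge0 : 0 <= j by nia.
have [f ef] : exists f : nat, j = f%:Z by exists (absz (j)); lia.
have [r' er] : exists r' : nat, r = r'%:Z by exists (absz (r)); lia.
have e' : (p * n = f * (p + q) + r')%N by lia.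
have -> : height p q n = f.
  by rewrite /height e' divnMDl ?divn_small ?addn0; lia.
have -> : resid p q n = r' by apply: residP e' _; lia.
by split; lia.
Qed.

Lemma time_at_sorted (p q : nat) : (0 < p)%N -> (0 < q)%N ->
  sorted elt (mkseq (time_at p q) (p + q).*2).
Proof.
move=> p_gt0 q_gt0; apply/(sortedP (0, 0)) => m; rewrite size_mkseq => lt_m.
by rewrite !nth_mkseq //; [apply: time_at_lt|lia].
Qed.

Lemma crossed_edges (p q : nat) : (0 < p)%N -> (0 < q)%N ->
  perm_eq [seq e <- cand_edges p q | crossing p q e]
          (mkseq (edge_at p q) (p + q).*2).
Proof.
move=> p_gt0 q_gt0.
apply: uniq_perm.
- exact/filter_uniq/uniq_cand_edges.
(* Equal edges have equal crossing parameters, but these increase strictly. *)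
- rewrite map_inj_in_uniq ?iota_uniq // => m m'; rewrite !mem_iota => lt_m lt_m' em.
  have := crossing_edge_at p_gt0 q_gt0 lt_m'; rewrite -em crossing_edge_at //.
  case=> et _; have srt := time_at_sorted p_gt0 q_gt0.
  have := sorted_ltn_nth elt_trans (0, 0) srt.
  case: (ltngtP m m') => // lt_mm H.
    by have := H m m'; rewrite !inE size_mkseq !nth_mkseq // et elt_irr => /(_ lt_m lt_m' lt_mm).
  by have := H m' m; rewrite !inE size_mkseq !nth_mkseq // et elt_irr => /(_ lt_m' lt_m lt_mm).
move=> e; rewrite mem_filter; apply/andP/mapP => [[cr /mem_cand_edges]|].
  move=> [i [j [i_b j_b]]]; rewrite !inE => /or3P[] /eqP ee; move: cr; rewrite ee.
  - rewrite crossing_x //; case: ifP => // H _.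
    have [n en] : exists n : nat, i + j + 1 = n%:Z by exists (absz (i + j + 1)); nia.
    (* In all three cases the residue is p + p i - q j, written so that the crossing conditions
       bound it. *)
    have [||ef ei er] := @edge_at_cell p q n i j (p%:Z - (q%:Z * j - p%:Z * i)) en; [lia|lia|].
    exists n.*2; first by rewrite mem_iota; nia.
    by rewrite /edge_at odd_double doubleK ei ef ifT //; lia.
  - rewrite crossing_z //; case: ifP => // H _.
    have [n en] : exists n : nat, i + j + 1 = n%:Z by exists (absz (i + j + 1)); nia.
    have [||ef ei er] := @edge_at_cell p q n i j (p%:Z + (p%:Z * i - q%:Z * j)) en; [lia|lia|].
    exists n.*2; first by rewrite mem_iota; nia.
    by rewrite /edge_at odd_double doubleK ei ef ifN //; lia.
  rewrite crossing_y //; case: ifP => // H _.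
  have [n en] : exists n : nat, i + j + 1 = n%:Z by exists (absz (i + j + 1)); lia.
  have [||ef ei er] := @edge_at_cell p q n i j
    ((p + q)%:Z - (q%:Z * (j + 1) - p%:Z * i)) en; [lia|lia|].
  exists n.*2.+1; first by rewrite mem_iota; lia.
  by rewrite /edge_at oddS odd_double /= uphalf_double ei ef.
move=> [m]; rewrite mem_iota => lt_m ->; rewrite crossing_edge_at //; split=> //.
have lt_n : (m./2 < p + q)%N by lia.
have [[lt_r lt_f le_f le_n] _] := height_bounds p_gt0 q_gt0 lt_n.
apply/mem_cand_edges; exists (m./2%:Z - 1 - (height p q m./2)%:Z), (height p q m./2)%:Z.
split; [lia|lia|rewrite /edge_at !inE].
by case: ifP => _; [|case: ifP => _]; rewrite eqxx ?orbT.
Qed.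

Lemma pmap_filter_isSome (S T : Type) (f : S -> option T) (s : seq S) :
  pmap f [seq x <- s | f x] = pmap f s.
Proof. by elim: s => //= x s IHs; case E: (f x) => [y|] //=; rewrite E /= IHs. Qed.

Lemma omega_barE (p q : nat) : (0 < p)%N -> (0 < q)%N ->
  omega_bar p q = mkseq (code p q) (p + q).*2.
Proof.
move=> p_gt0 q_gt0; rewrite /omega_bar.
set leT := fun u v => _; set d2 := (p + q).*2.
pose g m := (time_at p q m, code p q m).
pose S := mkseq g d2.
have eS : pmap (crossing p q) (mkseq (edge_at p q) d2) = S.
  rewrite /S /mkseq.
  have : {in iota 0 d2, forall m, crossing p q (edge_at p q m) = Some (g m)}.
    by move=> m; rewrite mem_iota => H; apply: crossing_edge_at.
  elim: (iota 0 d2) => //= m l IHl H.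
  rewrite H ?mem_head //= IHl // => m' m'_in.
  by apply: H; rewrite in_cons m'_in orbT.
have pS : perm_eq (pmap (crossing p q) (cand_edges p q)) S.
  by rewrite -eS -pmap_filter_isSome; apply: perm_pmap; exact: crossed_edges.
have tS : map fst S = mkseq (time_at p q) d2 by rewrite /S /mkseq -map_comp.
suff -> : sort leT (pmap (crossing p q) (cand_edges p q)) = S.
  by rewrite /S /mkseq -map_comp.
have uS : uniq (map fst S).
  by rewrite tS; exact: sorted_uniq elt_trans elt_irr _ (time_at_sorted p_gt0 q_gt0).
symmetry; apply: (@sorted_eq_in _ leT).
- by move=> u v w _ _ _; apply: ele_trans.
(* The order compares parameters only; it is antisymmetric on these crossings because their
   parameters are distinct. *)
- move=> _ _ /mapP[m m_in ->] /mapP[m' m'_in ->] /ele_anti /= et.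
  move: m_in m'_in; rewrite !mem_iota => lt_m lt_m'.
  have := @nth_uniq _ (0, 0) _ m m' _ _ uS; rewrite tS size_mkseq !nth_mkseq // et eqxx.
  by move=> /(_ lt_m lt_m') /esym/eqP ->.
- have : sorted ele (map fst S).
    by rewrite tS; exact: sub_sorted (@elt_ele) _ (time_at_sorted p_gt0 q_gt0).
  by rewrite sorted_map.
- by apply: sort_sorted => u v; apply: ele_total.
by rewrite perm_sym perm_sort.
Qed.

Theorem theorem5p6 (k1 k2 k3 : nat) (s : 'S_3) (p q : nat) :
  (0 < p)%N -> (0 < q)%N -> coprime p q ->
  (exists w : seq bool, FT_mid w = (p, q)) /\
  (forall w : seq bool, FT_mid w = (p, q) ->
     Cohn_mid k1 k2 k3 s w =
     mx2 (-1) 0 0 1 *m Mbar k1 k2 k3 s p q *m mx2 1 0 0 (-1)).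
Proof.
move=> p_gt0 q_gt0 co; split; first exact: FT_mid_surj.
move=> w; rewrite Mbar_cohn ?omega_barE //.
rewrite /FT_mid /Cohn_mid; have := Cohn_invariantP k1 k2 k3 s w.
case: (FT_vertex w) => [[r t] u].
case: (C_vertex _ _ _ _ w) => [[[[? ?] [? ?]] [? ?]] [[Cr Ct] Cu]].
by move=> [_ _ _ [_ et _]] /= tE; rewrite et tE.
Qed.
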